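(* Let $(T_t)_{t\ge 0}$ be a hypercyclic $C_0$-semigroup on a Banach space $X$. Then exactly one of the following four assertions holds: (1) every vector in $X$ is asymptotic to zero with density one for $(T_t)_{t\ge0}$; (2) generic vectors in $X$ are distributionally irregular of type $1$ for $(T_t)_{t\ge0}$; (3) generic vectors in $X$ are distributionally irregular of type $2\frac{1}{2}$ for $(T_t)_{t\ge0}$, and no hypercyclic vector for $(T_t)_{t\ge0}$ is distributionally irregular of type $1$ for $(T_t)_{t\ge0}$; (4) every hypercyclic vector for $(T_t)_{t\ge0}$ in $X$ is divergent to infinity with density one for $(T_t)_{t\ge0}$.
   Context: A one-parameter family $(T_t)_{t\ge0}$ of bounded linear operators on a Banach space $X$ is a $C_0$-semigroup if $T_0=I$, $T_{t+s}=T_tT_s$ for all $t,s\ge0$, and $\lim_{t\to s}T_tx=T_sx$ for all $x\in X$ and $s\ge 0$. It is hypercyclic if there is $x\in X$ whose orbit $\{T_tx: t\ge0\}$ is dense in $X$; such an $x$ is called a hypercyclic vector for $(T_t)_{t\ge0}$. Densities: for a Lebesgue measurable set $A\subset[0,\infty)$, with $\mu$ the Lebesgue measure on $[0,\infty)$, the lower and upper densities are $\underline{\mathrm{Dens}}(A)=\liminf_{t\to\infty}\frac{\mu(A\cap[0,t])}{t}$ and $\overline{\mathrm{Dens}}(A)=\limsup_{t\to\infty}\frac{\mu(A\cap[0,t])}{t}$. If they are equal, the density of $A$ exists and the common value is denoted $\mathrm{Dens}(A)$. A vector $x\in X$ is: - distributionally irregular of type $1$ for $(T_t)_{t\ge0}$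 if there exist measurable $A,B\subset\mathbb{R}_{\ge0}$ with $\overline{\mathrm{Dens}}(A)=\overline{\mathrm{Dens}}(B)=1$, $\lim_{A\ni t\to\infty}\|T_tx\|=0$ and $\lim_{B\ni t\to\infty}\|T_tx\|=\infty$; - distributionally irregular of type $2\frac12$ for $(T_t)_{t\ge0}$ if there exist measurable $A,B\subset\mathbb{R}_{\ge0}$ with $\overline{\mathrm{Dens}}(A)\,\overline{\mathrm{Dens}}(B)>0$, $\lim_{A\ni t\to\infty}\|T_tx\|=0$ and $\lim_{B\ni t\to\infty}\|T_tx\|=\infty$; - asymptotic to zero with density one if there exists a measurable $A\subset\mathbb{R}_{\ge0}$ with $\mathrm{Dens}(A)=1$ and $\lim_{A\ni t\to\infty}\|T_tx\|=0$; - divergent to infinity with density one if there exists a measurable $A\subset\mathbb{R}_{\ge0}$ with $\mathrm{Dens}(A)=1$ and $\lim_{A\ni t\to\infty}\|T_tx\|=\infty$. ''Generic vectors in $X$ have property P'' means that the set of vectors in $X$ satisfying P contains a dense $G_\delta$ subset of $X$. *)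

(* Defs.v *)
From HB Require Import structures.
From mathcomp Require Import all_boot all_order all_algebra.
From mathcomp Require Import complex.
From mathcomp Require Import all_classical all_reals all_analysis borel_hierarchy.

Set Implicit Arguments.
Unset Strict Implicit.
Unset Printing Implicit Defensive.

Import Order.TTheory GRing.Theory Num.Theory.
Import numFieldNormedType.Exports.

Local Open Scope classical_set_scope.
Local Open Scope ring_scope.

(* The scalars of a Banach space: the complex numbers or the real numbers.
   Time is always real. *)
Definition scalars (R : realType) (is_complex : bool) : numFieldType :=
  if is_complex return numFieldType then (R[i]%C : numFieldType)
  else (R : numFieldType).

Section densities.
Context {R : realType}.
Implicit Types A : set R.

(* [measurable A] would mean Borel measurable; the Lebesgue measurable sets are
   the Caratheodory measurable ones. *)
Definition lebesgue_measurable A : Prop :=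
  ((@wlength R idfun)^*%mu).-cara.-measurable A.

(* The value at [t <= 0] is irrelevant, since only t --> +oo is considered. *)
Definition mean_measure A (t : R) : \bar R :=
  (completed_lebesgue_measure (A `&` `[0%R, t]) * (t^-1)%:E)%E.

Definition lower_Dens A : \bar R := limf_einf (mean_measure A) (pinfty_nbhs R).

Definition upper_Dens A : \bar R := limf_esup (mean_measure A) (pinfty_nbhs R).

Definition has_Dens A (d : \bar R) : Prop := lower_Dens A = d /\ upper_Dens A = d.

Definition time_set A : Prop := A `<=` `[0, +oo[ /\ lebesgue_measurable A.

End densities.

Section semigroups.
Context {R : realType} {K : numFieldType} {X : completeNormedModType K}.
(* Operators at negative times are unconstrained and never used. *)
Implicit Types (T : R -> {linear X -> X}) (x : X).

Record C0_semigroup T : Prop := {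
  C0_bounded : forall t : R, 0 <= t ->
    exists M : K, forall x, `|T t x| <= M * `|x| ;
  C0_at0 : forall x, T 0 x = x ;
  C0_add : forall (t s : R) x, 0 <= t -> 0 <= s -> T (t + s) x = T t (T s x) ;
  C0_cont : forall x (s : R), 0 <= s ->
    T t x @[t --> within `[0%R, +oo[ (nbhs s)] --> T s x }.

Definition hypercyclic_vector T x : Prop := dense [set T t x | t in `[0, +oo[].

Definition hypercyclic T : Prop := exists x, hypercyclic_vector T x.

Definition tends_to_zero_along T x (A : set R) : Prop :=
  `|T t x| @[t --> within A (pinfty_nbhs R)] --> (0 : K).

Definition tends_to_infinity_along T x (A : set R) : Prop :=
  `|T t x| @[t --> within A (pinfty_nbhs R)] --> pinfty_nbhs K.

Definition dist_irregular_type1 T x : Prop :=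
  exists A B : set R,
    [/\ time_set A, time_set B, upper_Dens A = 1%E /\ upper_Dens B = 1%E,
        tends_to_zero_along T x A & tends_to_infinity_along T x B].

Definition dist_irregular_type2half T x : Prop :=
  exists A B : set R,
    [/\ time_set A, time_set B, (0 < upper_Dens A * upper_Dens B)%E,
        tends_to_zero_along T x A & tends_to_infinity_along T x B].

Definition asymptotic_to_zero_density_one T x : Prop :=
  exists A : set R,
    [/\ time_set A, has_Dens A 1%E & tends_to_zero_along T x A].

Definition divergent_to_infinity_density_one T x : Prop :=
  exists A : set R,
    [/\ time_set A, has_Dens A 1%E & tends_to_infinity_along T x A].

Definition generic (P : X -> Prop) : Prop :=
  exists G : set X, [/\ dense G, Gdelta G & forall x, G x -> P x].

End semigroups.

Definition exactly_one_of_four (P1 P2 P3 P4 : Prop) : Prop :=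
  [\/ [/\ P1, ~ P2, ~ P3 & ~ P4],
      [/\ ~ P1, P2, ~ P3 & ~ P4],
      [/\ ~ P1, ~ P2, P3 & ~ P4]
    | [/\ ~ P1, ~ P2, ~ P3 & P4]].

(* Main.v *)
Require Import Defs.
From HB Require Import structures.
From mathcomp Require Import all_boot all_order all_algebra.
From mathcomp Require Import complex.
From mathcomp Require Import all_classical all_reals all_analysis borel_hierarchy.
From mathcomp Require Import measurable_realfun lra.
Import Order.TTheory GRing.Theory Num.Theory.
Import numFieldNormedType.Exports.
Local Open Scope classical_set_scope.
Local Open Scope ring_scope.

Set Implicit Arguments.
Unset Strict Implicit.
Unset Printing Implicit Defensive.

(** The idea is that what one hypercyclic vector x does at a positive rate,
generic vectors do as well, and arbitrarily closely to 0 or to infinity.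
Suppose that the orbit of x is in the set of norms below M for a proportion c'
of the time, up to arbitrarily late times. Then for every e > 0 each vector
(e / M) T_s x is in the ball of radius e at any rate c < c', and these vectors
are dense, since nonzero multiples of hypercyclic vectors are hypercyclic. The
vectors which spend that proportion of the time in the ball, up to some late time, form
an open set, because the semigroup is bounded on bounded time intervals. By
Baire's theorem, generic vectors visit every ball around 0 at rate c. The same
holds at infinity, with sets of norms above M. This is [generic_frequent].

If some hypercyclic vector is of type 1, both ends are visited at every rate
below 1 and generic vectors are of type 1. Otherwise, if some hypercyclic
vector is not divergent with density one, it has norm below some M at a
positive rate, and if some hypercyclic vector is not asymptotic to zero with
density one, it has norm above some 1 / M at a positive rate; when both occur,
generic vectors are of type 2 1/2. If the first does not occur, all hypercyclic
vectors are divergent with density one. If the second does not occur, all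
hypercyclic vectors are asymptotic to zero with density one, hence so is every
vector, being a sum of two hypercyclic vectors, as these are generic.

The cases exclude one another because a generic property holds at some
hypercyclic vector, and a vector with density one at one end cannot visit the
other end at a positive rate.

Vectors are compared through norms in the field of scalars itself, of which
only the archimedean property is used; real and complex spaces are then treated
together. *)

(** * Time spent in a set, and densities *)

Section density.
Context {R : realType}.
Implicit Types (S : set R) (c t : R).

Local Notation clm := (@completed_lebesgue_measure R).

Lemma borel_lebesgue S : measurable (S : set (measurableTypeR R)) ->
  lebesgue_measurable S.
Proof. by move=> mS; apply: sub_caratheodory. Qed.

Lemma clm_le S S' : S `<=` S' -> (clm S <= clm S')%E.
Proof. by move=> SS'; exact: le_outer_measure. Qed.

Lemma clm_segment t : 0 <= t -> clm `[0, t] = t%:E.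
Proof.
move=> t0; have := @lebesgue_measure_itv R `[0, t]; rewrite /= lte_fin.
move=> E; transitivity (lebesgue_measure (`[0, t]%classic : set R)) => //.
rewrite E; case: ltgtP t0 => // [t0 _|<- //].
by rewrite oppr0 adde0.
Qed.

Definition time_in S t : R := fine (clm (S `&` `[0, t])).

Lemma time_inE S t : 0 <= t -> clm (S `&` `[0, t]) = (time_in S t)%:E.
Proof.
move=> t0; rewrite /time_in fineK// ge0_fin_numE//.
by rewrite (@le_lt_trans _ _ t%:E) ?ltry// -clm_segment// clm_le//; exact: subIsetr.
Qed.

Lemma time_in_ge0 S t : 0 <= time_in S t.
Proof. exact: fine_ge0. Qed.

Lemma time_in_le S S' t : 0 <= t -> S `&` `[0, t] `<=` S' ->
  time_in S t <= time_in S' t.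
Proof.
move=> t0 SS'; rewrite -lee_fin -!time_inE//; apply: clm_le => s Ss.
by split; [exact: SS'|exact: Ss.2].
Qed.

Lemma time_in_ub S t : 0 <= t -> time_in S t <= t.
Proof.
move=> t0; rewrite -lee_fin -time_inE// -[leRHS]clm_segment//.
by apply: clm_le; exact: subIsetr.
Qed.

Lemma time_inU S S' t : 0 <= t ->
  time_in (S `|` S') t <= time_in S t + time_in S' t.
Proof.
move=> t0; rewrite -lee_fin EFinD -!time_inE// setIUl.
exact: outer_measureU2.
Qed.

Lemma time_inC S t : lebesgue_measurable S -> 0 <= t ->
  time_in S t + time_in (~` S) t = t.
Proof.
move=> mS t0; apply: EFin_inj; rewrite EFinD -!time_inE// -[RHS]clm_segment//.
by rewrite setIC [X in (_ + clm X)%E]setIC; apply/esym/mS.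
Qed.

Lemma time_in_early S (N t : R) : 0 <= N -> 0 <= t -> S `<=` `[0, N] ->
  time_in S t <= N.
Proof.
move=> N0 t0 SN; rewrite -lee_fin -time_inE// -[leRHS]clm_segment//.
by apply: clm_le => s [/SN].
Qed.

(** Both sides are Borel measures of S that agree on half-open intervals. *)
Lemma clm_shift S r : measurable (S : set (measurableTypeR R)) ->
  clm ((fun s => s + r) @^-1` S) = clm S.
Proof.
move=> mS.
have mf : measurable_fun setT ((fun s => s + r) : measurableTypeR R -> measurableTypeR R).
  by apply: continuous_measurable_fun => s; apply: cvgD; [exact: cvg_id|exact: cvg_cst].
have -> : clm S = lebesgue_measure S by [].
rewrite (@lebesgue_measure_unique _ (pushforward lebesgue_measure ((fun s => s + r) : measurableTypeR R -> measurableTypeR R)))//.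
move=> _ [[a b]] _ <-; rewrite /pushforward /=.
have E : (fun s => s + r) @^-1` `]a, b] = `]a - r, b - r]%classic.
  by apply/seteqP; split=> s /=; rewrite !in_itv/= ltrBlDr lerBrDr.
rewrite -[RHS]/(lebesgue_measure ((fun s => s + r) @^-1` `]a, b] : set R)) E !lebesgue_measure_itv/= !lte_fin ltrD2r; case: ifP => // _.
by rewrite -!EFinD; congr EFin; lra.
Qed.

(** Watching S from time r on changes the time spent in it by at most r, a
bounded amount that densities do not see. *)
Lemma time_in_shift S (r t : R) : measurable (S : set (measurableTypeR R)) ->
  0 <= r -> 0 <= t ->
  time_in S t <= time_in ((fun s => s + r) @^-1` S) t + r.
Proof.
move=> mS r0 t0; rewrite -lee_fin EFinD -!time_inE//.
apply: (@le_trans _ _ (clm (`[0, r] `|` (S `&` `[r, t + r])))).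
  apply: clm_le => s /= [Ss]; rewrite !in_itv/= => /andP[s0 st].
  have [sr|rs] := leP s r; [left|right]; first by rewrite s0.
  by rewrite (ltW rs)/=; split=> //; lra.
rewrite addeC; apply: le_trans (outer_measureU2 _ _ _) _.
apply: leeD; first by rewrite -[leRHS]clm_segment.
have mI : measurable (S `&` `[r, t + r] : set (measurableTypeR R)).
  by apply: measurableI => //; exact: measurable_itv.
rewrite -[leLHS](clm_shift r mI).
apply: clm_le => s /= [Ss]; rewrite !in_itv/= => /andP[? ?]; split => //=.
by apply/andP; split; lra.
Qed.

Lemma time_in_bigcup (F : nat -> set R) c t :
  (forall i, measurable (F i : set (measurableTypeR R))) ->
  {homo F : n m / (n <= m)%N >-> n `<=` m} -> 0 <= t ->
  c < time_in (\bigcup_n F n) t -> exists n, c < time_in (F n) t.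
Proof.
move=> mF ndF t0 ct.
pose G n : set (measurableTypeR R) := F n `&` `[0, t].
have mG n : measurable (G n).
  by apply: measurableI; [exact: mF|exact: measurable_itv].
have cv : (fun n => clm (G n)) @ \oo --> clm ((\bigcup_n F n) `&` `[0, t]).
  rewrite setI_bigcupl; apply: (@nondecreasing_cvg_mu _ _ _
    (@lebesgue_measure R) G mG (bigcupT_measurable _ mG)).
  move=> n m nm; apply/subsetPset => s [Fs ?]; split=> //.
  exact: ndF nm _ Fs.
apply: contrapT => /forallNP H; move: ct; apply/negP; rewrite -leNgt.
rewrite -lee_fin -time_inE//.
rewrite -(cvg_lim _ cv)//; apply: lime_le; first by apply/cvg_ex; eexists; exact: cv.
by apply: nearW => n; rewrite /G time_inE// lee_fin leNgt; apply/negP/H.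
Qed.

(** Strict inequalities at single times, in place of the extended-real limits:
to hold for all c < d amounts to an upper, resp. lower, density of at least d,
and each can be compared between sets whose measures differ by a constant. *)
Definition often S c := forall N : R, exists2 t, N < t & c * t < time_in S t.
Definition always S c := exists N : R, forall t, N < t -> c * t < time_in S t.

Lemma mean_measureE S t : 0 < t -> mean_measure S t = (time_in S t / t)%:E.
Proof. by move=> t0; rewrite /mean_measure time_inE ?ltW// -EFinM. Qed.

Lemma upper_Dens_ge S c : often S c -> (c%:E <= upper_Dens S)%E.
Proof.
move=> oS; rewrite /upper_Dens limf_esupE; apply: le_ereal_inf_tmp => _ [V [N [_ NV]] <-].
have [t Nt ct] := oS (Num.max N 0).
have [Nt' t0] : N < t /\ 0 < t by move: Nt; rewrite gt_max => /andP.
apply: le_ereal_sup_tmp; exists (mean_measure S t).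
  by exists t => //; exact: NV.
by rewrite mean_measureE// lee_fin ler_pdivlMr// ltW.
Qed.

Lemma upper_Dens_gt S c : (c%:E < upper_Dens S)%E -> often S c.
Proof.
rewrite /upper_Dens limf_esupE => cS N.
have : (c%:E < ereal_sup (mean_measure S @` [set t | (Num.max N 0 < t)%R]))%E.
  apply: lt_le_trans cS _; apply: ereal_inf_lbound; eexists; last by [].
  by exists (Num.max N 0); split; rewrite ?num_real.
move=> /ereal_sup_gt[_ [t /= Nt <-]].
have [Nt' t0] : N < t /\ 0 < t by move: Nt; rewrite gt_max => /andP.
by rewrite mean_measureE// lte_fin ltr_pdivlMr// => ct; exists t.
Qed.

Lemma lower_Dens_ge S c : always S c -> (c%:E <= lower_Dens S)%E.
Proof.
move=> [N NS]; rewrite /lower_Dens limf_einfE; apply: le_ereal_sup_tmp.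
exists (ereal_inf (mean_measure S @` [set t | (Num.max N 0 < t)%R])).
  eexists; last by [].
  by exists (Num.max N 0); split; rewrite ?num_real.
apply: le_ereal_inf_tmp => _ [t /= Nt <-].
have [Nt' t0] : N < t /\ 0 < t by move: Nt; rewrite gt_max => /andP.
by rewrite mean_measureE// lee_fin ler_pdivlMr// ltW// NS.
Qed.

Lemma lower_Dens_gt S c : (c%:E < lower_Dens S)%E -> always S c.
Proof.
rewrite /lower_Dens limf_einfE => /ereal_sup_gt[_ [V [N [_ NV]] <-] cV].
exists (Num.max N 0) => t Nt.
have [Nt' t0] : N < t /\ 0 < t by move: Nt; rewrite gt_max => /andP.
have : (c%:E < mean_measure S t)%E.
  by apply: lt_le_trans cV _; apply: ereal_inf_lbound; exists t => //; exact: NV.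
by rewrite mean_measureE// lte_fin ltr_pdivlMr.
Qed.

Lemma always_often S c : always S c -> often S c.
Proof.
move=> [N NS] M; exists (Num.max N M + 1).
  by rewrite (@le_lt_trans _ _ (Num.max N M)) ?le_max ?lexx ?orbT// ltrDl.
by apply: NS; rewrite (@le_lt_trans _ _ (Num.max N M)) ?le_max ?lexx// ltrDl.
Qed.

Lemma upper_Dens_le1 S : (upper_Dens S <= 1)%E.
Proof.
rewrite leNgt; apply/negP => /upper_Dens_gt /(_ 0)[t t0].
by rewrite mul1r ltNge time_in_ub// ltW.
Qed.

Lemma upper_Dens_ge_lim S c : (forall c', c' < c -> often S c') ->
  (c%:E <= upper_Dens S)%E.
Proof.
move=> H; apply/lee_subgt0Pr => e e0; rewrite -EFinB; apply/upper_Dens_ge/H; lra.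
Qed.

Lemma has_Dens1 S : (forall c, c < 1 -> always S c) <-> has_Dens S 1%E.
Proof.
split=> [H|[lS _] c c1]; last by apply: lower_Dens_gt; rewrite lS lte_fin.
have uS : upper_Dens S = 1%E.
  apply/eqP; rewrite eq_le upper_Dens_le1/=.
  by apply: upper_Dens_ge_lim => c /H /always_often.
split=> //; apply/eqP; rewrite eq_le; apply/andP; split; last first.
  by apply/lee_subgt0Pr => e e0; rewrite -EFinB; apply/lower_Dens_ge/H; lra.
rewrite leNgt; apply/negP => /lower_Dens_gt/always_often /(_ 0)[t t0].
by rewrite mul1r ltNge time_in_ub// ltW.
Qed.

Lemma upper_Dens_ge0 S : (0 <= upper_Dens S)%E.
Proof.
apply: upper_Dens_ge_lim => c c0 N; exists (Num.max N 0 + 1).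
  by rewrite (@le_lt_trans _ _ (Num.max N 0)) ?le_max ?lexx ?orbT// ltrDl.
apply: lt_le_trans (time_in_ge0 _ _); rewrite pmulr_llt0//.
by rewrite (@le_lt_trans _ _ (Num.max N 0)) ?le_max ?lexx ?orbT// ltrDl.
Qed.

(** A bounded difference r of measures is absorbed by the linear gap
(c' - c) * t as soon as t exceeds r / (c' - c). *)
Lemma often_perturb S S' (c c' r : R) : c < c' ->
  (forall t, 0 <= t -> time_in S' t <= time_in S t + r) ->
  often S' c' -> often S c.
Proof.
move=> cc' SS' oS N.
have [t Nt ct] := oS (Num.max N (Num.max 0 (r / (c' - c)))).
move: Nt; rewrite !gt_max => /and3P[Nt t0]; rewrite ltr_pdivrMr ?subr_gt0// => rt.
by exists t => //; have := SS' t (ltW t0); lra.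
Qed.

Lemma always_perturb S S' (c c' r : R) : c < c' ->
  (forall t, 0 <= t -> time_in S' t <= time_in S t + r) ->
  always S' c' -> always S c.
Proof.
move=> cc' SS' [N NS]; exists (Num.max N (Num.max 0 (r / (c' - c)))) => t.
rewrite !gt_max => /and3P[Nt t0]; rewrite ltr_pdivrMr ?subr_gt0// => rt.
by have := SS' t (ltW t0); have := NS t Nt; lra.
Qed.

(** At a common time t > 0, disjoint sets would fill more than the
interval [0, t]. *)
Lemma often_always S S' c c' : lebesgue_measurable S -> S' `<=` ~` S ->
  0 <= c + c' - 1 -> always S c -> often S' c' -> False.
Proof.
move=> mS SS' cc' [N NS] /(_ (Num.max N 0))[t]; rewrite gt_max => /andP[Nt t0].
have := NS _ Nt; have := time_inC mS (ltW t0).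
have : time_in S' t <= time_in (~` S) t.
  by apply: time_in_le (ltW t0) _ => s [/SS'].
nra.
Qed.

Lemma not_always_often S S' c c' : lebesgue_measurable S ->
  ~` S `&` `[0, +oo[ `<=` S' ->
  c + c' < 1 -> ~ always S c -> often S' c'.
Proof.
move=> mS SS' cc' nS N; apply: contrapT => H; apply: nS.
exists (Num.max N 0) => t; rewrite gt_max => /andP[Nt t0].
rewrite ltNge; apply/negP => tc; apply: H; exists t => //.
have := time_inC mS (ltW t0).
have : time_in (~` S) t <= time_in S' t.
  apply: time_in_le (ltW t0) _ => s [Ss]; rewrite /= in_itv/= => /andP[s0 _].
  by apply: SS'; split=> //=; rewrite in_itv/= s0.
nra.
Qed.

End density.

(** * Diagonal sets *)

Section diagonal.
Context {R : realType}.
Implicit Types (S : (set R)^nat) (f : nat -> R) (c t : R).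

(** With S decreasing and f increasing to infinity, this set follows S k on
[f k, f k.+1). It is thus eventually inside every S k, yet up to time f k.+1 it
contains S k; the choice of f decides which density it inherits. *)
Definition diagonal S f : set R :=
  [set s | 0 <= s /\ forall k, f k <= s -> S k s].

Section diagonal_theory.
Variables (S : (set R)^nat) (f : nat -> R).
Hypotheses (mS : forall k, measurable (S k : set (measurableTypeR R))).
Hypotheses (Sdec : forall j k, (j <= k)%N -> S k `<=` S j).
Hypotheses (f0 : 0 <= f 0%N) (fS : forall k, f k + 1 <= f k.+1).

Lemma step_homo j k : (j <= k)%N -> f j <= f k.
Proof.
by apply: (homo_leq (r := fun x y => x <= y)) => // [y x z|n];
  [exact: le_trans|have := fS n; lra].
Qed.

Lemma step_ge_nat k : k%:R <= f k.
Proof.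
by elim: k => [//|k IH]; have := fS k; rewrite -natr1; lra.
Qed.

Lemma measurable_diagonal : measurable (diagonal S f : set (measurableTypeR R)).
Proof.
have -> : diagonal S f = `[0, +oo[ `&` \bigcap_k (~` `[f k, +oo[ `|` S k).
  apply/seteqP; split=> s /=.
    move=> [s0 H]; split; first by rewrite in_itv/= s0.
    move=> k _ /=; rewrite in_itv/= andbT.
    by have [/H|] := boolP (f k <= s); [right|left].
  rewrite in_itv/= andbT => -[s0 H]; split=> // k fk.
  by have [|//] := H k I; rewrite /= in_itv/= fk.
apply: measurableI; first exact: measurable_itv.
apply: bigcapT_measurable => k; apply: measurableU => //.
by apply: measurableC; exact: measurable_itv.
Qed.

Lemma time_in_diagonal k t : 0 <= t -> t < f k.+1 ->
  time_in (S k) t <= time_in (diagonal S f) t.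
Proof.
move=> t0 tk; apply: time_in_le => // s [Sks] /=; rewrite in_itv/= => /andP[s0 st].
split=> // j fj; have [jk|kj] := leqP j k; first exact: Sdec jk _ Sks.
by have := step_homo kj; lra.
Qed.

End diagonal_theory.

Lemma nat_above (x : R) : exists n : nat, x < n.+1%:R.
Proof. by exists (Num.truncn x); exact: truncnS_gt. Qed.

Lemma rate_approx (d c : R) : c < d ->
  exists k0, forall k, (k0 <= k)%N -> c <= d - k.+1%:R^-1.
Proof.
move=> cd; have [k0 H] := nat_above (d - c)^-1; exists k0 => k k0k.
have : k.+1%:R^-1 <= d - c.
  rewrite -[leRHS]invrK lef_pV2 ?posrE ?invr_gt0 ?subr_gt0//.
  by rewrite (le_trans (ltW H))// ler_nat ltnS.
by move=> H1; rewrite lerBrDr addrC -lerBrDr.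
Qed.

Section diagonal_densities.
Variable S : (set R)^nat.
Hypotheses (mS : forall k, measurable (S k : set (measurableTypeR R))).
Hypotheses (Sdec : forall j k, (j <= k)%N -> S k `<=` S j).

(** f k.+1 is placed just after a time at which S k has been visited at rate
d - 1/(k+1); the diagonal set still contains S k at that time. *)
Lemma diagonal_often (d : R) : (forall k c, c < d -> often (S k) c) ->
  exists D : set R, [/\ time_set D,
    forall k, exists N, forall s, N < s -> D s -> S k s &
    (d%:E <= upper_Dens D)%E].
Proof.
move=> H.
have /choice[g gP] : forall kN : nat * R, exists t,
    kN.2 < t /\ (d - kN.1.+1%:R^-1) * t < time_in (S kN.1) t.
  move=> [k N] /=; have [|t Nt ct] := H k (d - k.+1%:R^-1) _ N; last by exists t.
  by rewrite ltrBlDr ltrDl.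
pose fix f n := if n is k.+1 then g (k, f k) + 1 else 0.
have fS k : f k + 1 <= f k.+1.
  by rewrite /= lerD2r ltW//; case: (gP (k, f k)).
exists (diagonal S f); split.
- split; first by move=> s [s0 _]; rewrite /= in_itv/= s0.
  by apply: borel_lebesgue; exact: measurable_diagonal.
- by move=> k; exists (f k) => s fs [_ /(_ k (ltW fs))].
- apply: upper_Dens_ge_lim => c /rate_approx[k0 k0P] N.
  have [k1 k1P] := nat_above N; pose k := maxn k0 k1.+1.
  have /= [fk ck] := gP (k, f k).
  have kf : k%:R <= f k by exact: step_ge_nat.
  have Nk : N < k%:R by apply: lt_le_trans k1P _; rewrite ler_nat leq_maxr.
  have k0k : 0 < k%:R :> R by rewrite ltr0n /k leq_max orbT.
  exists (g (k, f k)); first lra.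
  apply: (@le_lt_trans _ _ ((d - k.+1%:R^-1) * g (k, f k))).
    by rewrite ler_wpM2r// ?k0P ?leq_maxl//; lra.
  apply: lt_le_trans ck _; apply: time_in_diagonal => //=; lra.
Qed.

(** f k is placed after the time from which S k is always visited at rate
1 - 1/(k+1), so each time in [f k, f k.+1) can be compared with S k. *)
Lemma diagonal_always : (forall k c, c < 1 -> always (S k) c) ->
  exists D : set R, [/\ time_set D,
    forall k, exists N, forall s, N < s -> D s -> S k s & has_Dens D 1%E].
Proof.
move=> H.
have /choice[g gP] : forall k : nat, exists N, forall t, N < t ->
    (1 - k.+1%:R^-1) * t < time_in (S k) t.
  by move=> k; apply: H; rewrite ltrBlDr ltrDl.
pose fix f n := if n is k.+1 then Num.max (f k) (g k.+1) + 1 else 0.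
have fS k : f k + 1 <= f k.+1 by rewrite /= lerD2r le_max lexx.
exists (diagonal S f); split.
- split; first by move=> s [s0 _]; rewrite /= in_itv/= s0.
  by apply: borel_lebesgue; exact: measurable_diagonal.
- by move=> k; exists (f k) => s fs [_ /(_ k (ltW fs))].
- apply/has_Dens1 => c /rate_approx[k0 k0P]; exists (f k0.+1) => t tk0.
  have ex : exists j, t < f j.+1.
    have [j jP] := nat_above t; exists j.
    exact: lt_le_trans jP (step_ge_nat _ fS j.+1).
  (* j is least, so that f j <= t < f j.+1 *)
  case: (ex_minnP ex) => j tj minj.
  have k0j : (k0 < j)%N.
    rewrite ltnNge; apply/negP => jk.
    by have := step_homo fS (jk : (j.+1 <= k0.+1)%N); lra.
  case: j => // j in tj minj k0j *.
  have fj : f j.+1 <= t by rewrite leNgt; apply/negP => /minj; rewrite ltnn.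
  have gj : g j.+1 < t.
    apply: lt_le_trans fj => /=; rewrite (@le_lt_trans _ _ (Num.max (f j) (g j.+1)))//.
    by rewrite le_max lexx orbT.
    by rewrite ltrDl.
  have t0 : 0 <= t by apply: le_trans (ler0n _ _) (le_trans (step_ge_nat _ fS j.+1) fj).
  apply: lt_le_trans (time_in_diagonal Sdec fS t0 tj).
  apply: le_lt_trans (gP _ _ gj).
  by rewrite ler_wpM2r// k0P// ltnW.
Qed.

End diagonal_densities.
End diagonal.

(** * Baire category over an archimedean field of scalars *)

Section baire.
Context {K : numFieldType} {X : completeNormedModType K}.
Hypothesis arch : forall x : K, 0 <= x -> exists n : nat, x < n.+1%:R.

Lemma open_normP (O : set X) : open O <->
  forall x, O x -> exists2 r : K, 0 < r & forall v, `|v - x| < r -> O v.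
Proof.
rewrite openE; split=> H x Ox.
  have /nbhs_ballP[r /= r0 rO] := H x Ox.
  by exists r => // v vx; apply: rO; rewrite -ball_normE /ball_/= distrC.
have [r r0 rO] := H x Ox; apply/nbhs_ballP; exists r => //= v.
by rewrite -ball_normE /ball_/= distrC; exact: rO.
Qed.

Lemma open_ball_norm (x : X) (r : K) : open [set v | `|v - x| < r].
Proof.
apply/open_normP => v /= vr; exists (r - `|v - x|); first by rewrite subr_gt0.
move=> u uv; rewrite -(subrKA v) (le_lt_trans (ler_normD _ _))//.
by rewrite -ltrBrDr.
Qed.

Lemma dense_normP (S : set X) : dense S <->
  forall (x : X) (r : K), 0 < r -> exists2 v, S v & `|v - x| < r.
Proof.
split=> [dS x r r0|H O [x Ox] /open_normP/(_ x Ox)[r r0 rO]].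
  have [|v [vr Sv]] := dS [set v | `|v - x| < r] _ (open_ball_norm x r).
    by exists x; rewrite /= subrr normr0.
  by exists v.
by have [v Sv vx] := H x r r0; exists v; split=> //; exact: rO.
Qed.

Lemma arch_inv (e : K) : 0 < e -> exists n : nat, n.+1%:R^-1 < e.
Proof.
move=> e0; have [n en] := arch (ltW (eqbRL (invr_gt0 _) e0)).
by exists n; rewrite -[ltRHS]invrK ltf_pV2 ?posrE ?invr_gt0.
Qed.

(** Nested balls. The usual step is taken with balls of twice the radius, so
that the limit of the centres, which is only known to lie in the closed ball,
still satisfies the strict inequalities. *)
Lemma baire (F : (set X)^nat) : (forall n, open (F n)) ->
  (forall n, dense (F n)) -> dense (\bigcap_n F n).
Proof.
move=> oF dF D [a0 Da0] oD.
have [r0 r00 r0D] := (open_normP D).1 oD a0 Da0.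
have /choice[g gP] : forall np : nat * (X * K), exists q : X * K,
    0 < np.2.2 -> 0 < q.2 /\ forall v, `|v - q.1| < q.2 + q.2 ->
      [/\ `|v - np.2.1| < np.2.2, F np.1 v & `|v - q.1| < np.1.+1%:R^-1].
  move=> [n [a r]] /=; have [r0'|r0'] := boolP (0 < r); last by exists (a, r).
  have [b Fb ba] := (dense_normP (F n)).1 (dF n) a r r0'.
  pose O := [set v | `|v - a| < r] `&` F n `&` [set v | `|v - b| < n.+1%:R^-1].
  have oO : open O.
    by do !apply: openI; [exact: open_ball_norm|exact: oF|exact: open_ball_norm].
  have [|e e0 eO] := (open_normP O).1 oO b.
    by split=> //=; rewrite subrr normr0 invr_gt0.
  exists (b, e / 2) => _ /=; split; first by rewrite divr_gt0.
  by rewrite -splitr => v /eO[[? ?] ?].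
pose fix p n := if n is k.+1 then g (k, p k) else (a0, r0).
have p0 n : 0 < (p n).2 by elim: n => [//|n IH] /=; case: (gP (n, p n) IH).
have pS n v : `|v - (p n.+1).1| < (p n.+1).2 + (p n.+1).2 ->
    [/\ `|v - (p n).1| < (p n).2, F n v & `|v - (p n.+1).1| < n.+1%:R^-1].
  by have [_ /(_ v)] := gP (n, p n) (p0 n).
have pm n m : (n <= m)%N -> `|(p m).1 - (p n).1| < (p n).2.
  move=> nm; rewrite -(subnK nm); move: (m - n)%N => k {nm}; elim: k n => [|k IH] n.
    by rewrite add0n subrr normr0.
  rewrite addSnnS; have := IH n.+1 => h.
  have [] // := pS n (p (k + n.+1)%N).1.
  by rewrite (lt_trans h)// ltrDl.
have cv : cvg ((fun n => (p n).1) @ \oo).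
  apply: cauchy_cvg; apply: cauchy_exP => e e0.
  have [n ne] := arch_inv e0; exists (p n.+1).1; exists n.+1 => // m /= nm.
  rewrite -ball_normE /ball_/= distrC; apply: lt_trans ne.
  have [] // := pS n (p m).1.
  by rewrite (lt_trans (pm _ _ nm))// ltrDl.
have {}cv := cvgP _ cv.
set l := lim _ in cv.
have lp n : `|l - (p n).1| < (p n).2 + (p n).2.
  have : \forall m \near \oo, `|l - (p m).1| < (p n).2.
    by move/cvgrPdist_lt : cv; apply.
  move=> [m _ mP]; have := mP (maxn m n) (leq_maxl _ _) => /= h.
  rewrite -(subrKA (p (maxn m n)).1) (le_lt_trans (ler_normD _ _))//.
  by rewrite ltrD// pm// leq_maxr.
exists l; split.
  by apply: r0D; have [] := pS 0%N l (lp 1%N).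
by move=> n _; have [] := pS n l (lp n.+1).
Qed.

Lemma generic_dense (P : X -> Prop) : generic P -> dense P.
Proof.
move=> [G [dG _ GP]] O O0 oO; have [x [Ox Gx]] := dG O O0 oO.
by exists x; split=> //; exact: GP.
Qed.

Lemma genericS (P Q : X -> Prop) : (forall x, P x -> Q x) -> generic P -> generic Q.
Proof. by move=> PQ [G [? ? GP]]; exists G; split=> // x /GP/PQ. Qed.

Lemma open_dense_generic (U : set X) : open U -> dense U -> generic U.
Proof. by move=> oU dU; exists U; split=> //; exact: open_Gdelta. Qed.

(** A dense Gdelta set is an intersection of dense open sets, and countably many
such intersections are re-indexed into a single one. *)
Lemma generic_forall (J : countType) (P : J -> X -> Prop) :
  (forall i, generic (P i)) -> generic (fun x => forall i, P i x).
Proof.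
move=> gP.
have /choice[A AP] : forall i, exists A : (set X)^nat,
    [/\ forall n, open (A n), forall n, dense (A n) &
        forall x, (forall n, A n x) -> P i x].
  move=> i; have [G [dG [A oA GA] GP]] := gP i; exists A; split=> //.
    move=> n O O0 oO; have [x [Ox]] := dG O O0 oO.
    by rewrite GA => /(_ n I) Ax; exists x.
  by move=> x Ax; apply: GP; rewrite GA => n _; exact: Ax.
pose B n := if unpickle n is Some (i, k) then A i k else setT.
have oB n : open (B n).
  rewrite /B; case: unpickle => [[i k]|]; last exact: openT.
  by case: (AP i).
have dB n : dense (B n).
  rewrite /B; case: unpickle => [[i k]|].
    by case: (AP i).
  by move=> O [x Ox] _; exists x.
exists (\bigcap_n B n); split; first exact: baire.
  by exists B.
move=> x Bx i; have [_ _] := AP i; apply => k.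
by have := Bx (pickle (i, k)) I; rewrite /B pickleK.
Qed.

Lemma genericI (P Q : X -> Prop) : generic P -> generic Q ->
  generic (fun x => P x /\ Q x).
Proof.
move=> gP gQ; have : forall b : bool, generic (if b then P else Q) by case.
move=> /generic_forall; apply: genericS => x H.
by split; [exact: (H true)|exact: (H false)].
Qed.

Lemma generic_exists (P : X -> Prop) : generic P -> exists x, P x.
Proof.
move=> /generic_dense/(_ setT)[||x [_ Px]]; first by exists 0.
  exact: openT.
by exists x.
Qed.

(** P and its reflection y |-> P (x - y) are both generic, hence have a common
point. *)
Lemma generic_sum (P : X -> Prop) (x : X) : generic P ->
  exists h1 h2, [/\ P h1, P h2 & x = h1 + h2].
Proof.
move=> gP; have gQ : generic (fun y => P (x - y)).
  have [G [dG [A oA GA] GP]] := gP.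
  have sub_isom (y z : X) : `|(x - y) - (x - z)| = `|y - z|.
    by rewrite opprB addrC addrA subrK distrC.
  exists [set y | G (x - y)]; split=> [||y]; last exact: GP.
  - apply/dense_normP => y r r0.
    have [v Gv vy] := (dense_normP G).1 dG (x - y) r r0.
    by exists (x - v); rewrite /= ?subKr// -sub_isom subKr.
  - exists (fun n => [set y | A n (x - y)]).
      move=> n; apply/open_normP => y Ay.
      have [r r0 rA] := (open_normP (A n)).1 (oA n) _ Ay; exists r => // v vy.
      by apply: rA; rewrite sub_isom.
    by rewrite GA; apply/seteqP; split=> y Hy n _; exact: (Hy n I).
have [y [Py Pxy]] := generic_exists (genericI gP gQ).
by exists y, (x - y); rewrite subrKC.
Qed.

End baire.

(** * Local boundedness and visit times *)

Section semigroup.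
Context {R : realType} {K : numFieldType} {X : completeNormedModType K}.
Hypothesis arch : forall x : K, 0 <= x -> exists n : nat, x < n.+1%:R.
Variable T : R -> {linear X -> X}.
Hypothesis T_C0 : C0_semigroup T.

(** The given constant need not be real when X is trivial, hence its
absolute value. *)
Lemma C0_bounded_pos t : 0 <= t ->
  exists2 M : K, 0 < M & forall x, `|T t x| <= M * `|x|.
Proof.
move=> t0; have [M H] := C0_bounded T_C0 t0; exists (`|M| + 1).
  by rewrite ltr_wpDl.
move=> x; rewrite (@le_trans _ _ (`|M| * `|x|))//; last first.
  by rewrite ler_wpM2r// lerDl.
rewrite -[X in _ * X]normr_id -normrM ger0_norm ?H//.
exact: le_trans (normr_ge0 _) (H x).
Qed.

Lemma C0_norm_cont x s (e : K) : 0 <= s -> 0 < e -> exists2 d : R, 0 < d &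
  forall t, 0 <= t -> `|t - s| < d -> `|T t x - T s x| < e.
Proof.
move=> s0 e0.
have /cvgrPdist_lt/(_ e e0) := C0_cont T_C0 (x := x) s0.
rewrite /prop_near1 /within/= => /nbhs_ballP[d /= d0 H]; exists d => // t t0 td.
rewrite distrC; apply: H; last by rewrite in_itv/= t0.
by rewrite -ball_normE /ball_/= distrC.
Qed.

Lemma T_commute t s x : 0 <= t -> 0 <= s -> T t (T s x) = T s (T t x).
Proof. by move=> t0 s0; rewrite -!(C0_add T_C0)// addrC. Qed.

(** Uniform boundedness through category: if every open set O n of vectors that
become longer than n before time 1/(n+1) were dense, some x would belong to all
of them, against the continuity of its orbit at time 0. A ball missing some O n
gives the bound. *)
Lemma small_time_bounded : exists h : R, exists2 C : K, 0 < h /\ 1 <= C &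
  forall s x, 0 <= s -> s <= h -> `|T s x| <= C * `|x|.
Proof.
pose O (n : nat) : set X := [set x | exists s : R,
  [/\ 0 <= s, s <= n.+1%:R^-1 & n%:R < `|T s x|]].
have oO n : open (O n).
  apply/open_normP => x [s [s0 sn nT]]; have [M M0 MT] := C0_bounded_pos s0.
  exists ((`|T s x| - n%:R) / M); first by rewrite divr_gt0 ?subr_gt0.
  move=> v; rewrite ltr_pdivlMr// mulrC => vx; exists s; split=> //.
  have := le_lt_trans (MT _) vx.
  rewrite linearB /= ltrBrDr -ltrBrDl => /lt_le_trans; apply.
  rewrite -{1}(subKr (T s v) (T s x)) lerBlDr.
  by rewrite (le_trans (ler_normB _ _))// [`|T s v - _|]distrC.
have [n nd] : exists n, ~ dense (O n).
  apply: contrapT => /forallNP H.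
  have dO n : dense (O n) by apply: contrapT.
  have [|x [_ Ox]] := baire arch oO dO _ openT; first by exists 0.
  have [d d0 dT] := C0_norm_cont x (lexx 0) (@ltr01 K).
  have [n1 n1P] := arch (ler_wpDl (normr_ge0 x) (@ler01 K)).
  have [n2 n2P] := nat_above d^-1.
  have [s [s0 sn]] := Ox (maxn n1.+1 n2) I; apply/negP.
  rewrite -real_leNgt ?realn ?normr_real//.
  have sd : `|s - 0| < d.
    rewrite subr0 ger0_norm// (le_lt_trans sn)// -[ltRHS]invrK.
    rewrite ltf_pV2 ?posrE ?invr_gt0// (lt_le_trans n2P)// ler_nat ltnS.
    exact: leq_maxr.
  have := dT s s0 sd; rewrite (C0_at0 T_C0) => Tx.
  rewrite -[T s x](subrK x) (le_trans (ler_normD _ _))//.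
  rewrite (@le_trans _ _ n1.+1%:R)//; last by rewrite ler_nat leq_maxl.
  by rewrite (le_trans _ (ltW n1P))// addrC lerD2l ltW.
have [x0 [r r0 H]] : exists x0, exists2 r : K, 0 < r &
    forall v, `|v - x0| < r -> ~ O n v.
  apply: contrapT => H; apply: nd; apply/dense_normP => x r r0.
  apply: contrapT => H'; apply: H; exists x, r => // v vx Ov.
  by apply: H'; exists v.
have bd s v : 0 <= s -> s <= n.+1%:R^-1 -> `|v| < r -> `|T s v| <= n%:R + n%:R.
  move=> s0 sn vr.
  have Hb w : `|w - x0| < r -> `|T s w| <= n%:R.
    move=> wr; rewrite real_leNgt ?realn ?normr_real//; apply/negP => nT.
    by apply: (H w wr); exists s.
  rewrite -[v](addrK x0) linearB/= (le_trans (ler_normB _ _))// lerD// Hb//.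
    by rewrite addrK.
  by rewrite subrr normr0.
pose C : K := (n%:R + n%:R) * 2 / r + 1.
exists n.+1%:R^-1, C.
  by rewrite invr_gt0 ltr0n lerDr !(mulr_ge0, addr_ge0)// invr_ge0 ltW.
move=> s x s0 sn; have [->|x0'] := eqVneq x 0.
  by rewrite linear0 !normr0 mulr0.
have nx : 0 < `|x| by rewrite normr_gt0.
pose a : K := r / 2 / `|x|.
have a0 : 0 < a by rewrite !divr_gt0.
have : `|T s (a *: x)| <= n%:R + n%:R.
  apply: bd => //; rewrite normrZ gtr0_norm// /a divfK ?gt_eqF//.
  by rewrite ltr_pdivrMr// ltr_pMr// ltr1n.
rewrite linearZ/= normrZ gtr0_norm// -ler_pdivlMl// => /le_trans; apply.
have -> : a^-1 * (n%:R + n%:R) = ((n%:R + n%:R) * 2 / r) * `|x|.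
  by rewrite /a !invfM !invrK mulrC [_^-1 * 2]mulrC !mulrA.
by rewrite ler_wpM2r// /C lerDl.
Qed.

Lemma locally_bounded (t : R) : exists2 C : K, 0 < C &
  forall s x, 0 <= s -> s <= t -> `|T s x| <= C * `|x|.
Proof.
have [h [C [h0 C1] CT]] := small_time_bounded.
have C0 : 0 < C by apply: lt_le_trans C1.
have [k kP] := nat_above (t / h).
have H j s x : 0 <= s -> s <= j%:R * h -> `|T s x| <= C ^+ j * `|x|.
  elim: j s x => [|j IH] s x s0.
    rewrite mul0r => s0'; have -> : s = 0 by apply/eqP; rewrite eq_le s0 s0'.
    by rewrite (C0_at0 T_C0) expr0 mul1r.
  rewrite -natr1 mulrDl mul1r => sj; have [sh|hs] := leP s h.
    by rewrite (le_trans (CT _ _ s0 sh))// ler_wpM2r// exprS ler_peMr ?exprn_ege1// ltW.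
  have -> : s = h + (s - h) by lra.
  rewrite (C0_add T_C0); [|lra|lra].
  rewrite (le_trans (CT _ _ (ltW h0) (lexx _)))// exprS -mulrA ler_pM2l//.
  by apply: IH; lra.
exists (C ^+ k.+1); first exact: exprn_gt0.
move=> s x s0 st; apply: H => //; rewrite (le_trans st)// -ler_pdivrMr//.
exact: ltW.
Qed.

Definition visit (O : set X) (x : X) : set R := [set s | 0 <= s /\ O (T s x)].

Lemma visitS (O O' : set X) x : O `<=` O' -> visit O x `<=` visit O' x.
Proof. by move=> OO' s [s0 /OO']. Qed.

Lemma measurable_visit O x : open O ->
  measurable (visit O x : set (measurableTypeR R)).
Proof.
move=> oO; (* the orbit, extended continuously to negative times *)
pose f s := T (Num.max 0 s) x.
have -> : visit O x = `[0, +oo[ `&` f @^-1` O.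
  apply/seteqP; split=> s /=; rewrite /f in_itv/= andbT => -[s0].
    by rewrite max_r.
  by rewrite max_r.
apply: measurableI; first exact: measurable_itv.
apply: open_measurable; apply: open_comp oO => s _.
apply/cvgrPdist_lt => e e0.
have m0 : 0 <= Num.max 0 s by rewrite le_max lexx.
have [d d0 dT] := C0_norm_cont x m0 e0.
apply/nbhs_ballP; exists d => //= t st; have {}st : `|s - t| < d by [].
rewrite distrC; apply: dT; first by rewrite le_max lexx.
apply: le_lt_trans st; rewrite [leRHS]distrC.
rewrite !maxEle; case: ifP => h1; case: ifP => h2; rewrite ?subr0 ?subrr ?normr0//.
- by rewrite !ger0_norm; lra.
- by rewrite sub0r normrN [leRHS]ler0_norm ?ger0_norm; lra.
Qed.

End semigroup.

(** * Transfer from one hypercyclic vector to generic vectors *)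

Section hypercyclic.
Context {R : realType} {K : numFieldType} {X : completeNormedModType K}.
Hypothesis arch : forall x : K, 0 <= x -> exists n : nat, x < n.+1%:R.
Variable T : R -> {linear X -> X}.
Hypothesis T_C0 : C0_semigroup T.
Local Notation visit := (visit T).

(** Asking for some e > r, and not for r itself, makes this set open. *)
Definition margin (O : set X) (r : K) : set X :=
  [set v | exists2 e, r < e & forall u, `|u - v| < e -> O u].

Lemma open_margin O r : open (margin O r).
Proof.
apply/open_normP => v [e re eO]; exists ((e - r) / 2).
  by rewrite divr_gt0// subr_gt0.
move=> w wv; exists (e - (e - r) / 2).
  rewrite ltrBrDr -ltrBrDl ltr_pdivrMr// mulr_natr mulr2n ltrDl.
  by rewrite subr_gt0.
move=> u uw; apply: eO; rewrite -(subrKA w) (le_lt_trans (ler_normD _ _))//.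
by rewrite -(subrK ((e - r) / 2) e) ltrD.
Qed.

Lemma margin_bigcup O : open O -> \bigcup_n margin O n.+1%:R^-1 = O.
Proof.
move=> oO; apply/seteqP; split=> [v [n _ [e ne]]|v Ov].
  by apply; rewrite subrr normr0 (lt_trans _ ne)// invr_gt0.
have [e e0 eO] := (open_normP O).1 oO v Ov; have [n ne] := arch_inv arch e0.
by exists n => //; exists e.
Qed.

(** By continuity of the measure, y spends more than c in some [margin O r],
with a uniform r > 0; local boundedness turns this into room for z near y. *)
Lemma open_long_visit (O : set X) (c t : R) : 0 <= t -> open O ->
  open [set y | c < time_in (visit O y) t].
Proof.
move=> t0 oO; apply/open_normP => y /= ct.
have [m mct] : exists m, c < time_in (visit (margin O m.+1%:R^-1) y) t.
  apply: time_in_bigcup => //.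
  - by move=> i; apply: measurable_visit => //; exact: open_margin.
  - move=> i j ij; apply: visitS => v [e ie eO]; exists e => //.
    by rewrite (le_lt_trans _ ie)// lef_pV2 ?posrE// ler_nat.
  - apply: lt_le_trans ct _; apply: time_in_le => // s [[s0 Os] _].
    move: Os; rewrite -{1}(margin_bigcup oO) => -[i _ Oi].
    by exists i.
have [C C0 CT] := locally_bounded arch T_C0 t.
exists (m.+1%:R^-1 / C); first by rewrite divr_gt0.
move=> z; rewrite ltr_pdivlMr// mulrC => zy.
apply: lt_le_trans mct _; apply: time_in_le => // s [[s0 [e me eO]]] /=.
rewrite in_itv/= => /andP[_ st]; split=> //; apply: eO.
by rewrite -linearB (le_lt_trans (CT _ _ s0 st))// (lt_trans zy).
Qed.

Lemma hypercyclic_normP x : hypercyclic_vector T x <->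
  forall (v : X) (r : K), 0 < r -> exists2 t, 0 <= t & `|T t x - v| < r.
Proof.
split=> [/dense_normP H v r r0|H].
  have [_ [t + <-] tr] := H v r r0; rewrite /= in_itv/= andbT => t0.
  by exists t.
apply/dense_normP => v r r0; have [t t0 tr] := H v r r0.
by exists (T t x) => //; exists t => //=; rewrite in_itv/= t0.
Qed.

(** The y that visit O k at rate c up to some time beyond n form an open set,
dense because it contains a multiple of T_s x for each s: that vector spends in
O k as much time as T_s x in Z, and shifting by s costs at most s, which the
gap between c and c' absorbs. Scaling all of the dense orbit makes one target Z
serve every O k at the same rate. *)
Lemma generic_often x (Z : set X) (O : (set X)^nat) (c c' : R) :
  hypercyclic_vector T x -> open Z -> (forall k, open (O k)) ->
  (forall k, exists2 a : K, a != 0 & forall v, Z v -> O k (a *: v)) ->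
  c < c' -> often (visit Z x) c' ->
  generic (fun y => forall k, often (visit (O k) y) c).
Proof.
move=> /hypercyclic_normP hx oZ oO ZO cc' oft.
pose U (kn : nat * nat) : set X :=
  \bigcup_(t in [set t | kn.2%:R < t]) [set y | c * t < time_in (visit (O kn.1) y) t].
suff : generic (fun y => forall kn, U kn y).
  apply: genericS => y Uy k N; have [n Nn] := nat_above N.
  have [t /= nt ct] := Uy (k, n.+1); exists t => //; lra.
apply: (generic_forall arch) => -[k n]; apply: open_dense_generic.
  apply: bigcup_open => t /= nt; apply: open_long_visit => //.
  by rewrite (le_trans _ (ltW nt)).
apply/dense_normP => v r r0; have [a a0 aZ] := ZO k.
have [s s0 sv] := hx (a^-1 *: v) (r / `|a|) ltac:(by rewrite divr_gt0// normr_gt0).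
exists (a *: T s x); last first.
  rewrite -[v](scale1r) -(divff a0) -scalerA -scalerBr normrZ mulrC.
  by rewrite -ltr_pdivlMr// normr_gt0.
have : often (visit (O k) (a *: T s x)) c.
  apply: (often_perturb (S' := visit Z x) (r := s) cc') => // t t0.
  apply: le_trans (time_in_shift (measurable_visit T_C0 x oZ) s0 t0) _.
  rewrite lerD2r; apply: time_in_le => // u [[_ Zu]]; rewrite /= in_itv/=.
  move=> /andP[u0 _]; split=> //; rewrite linearZ/= -(C0_add T_C0)//.
  exact: aZ.
by move=> /(_ n%:R)[t nt ct]; exists t.
Qed.

(** Being hypercyclic is meeting every ball around countably many dense centres.
The vectors whose orbit meets a given ball form an open set, which contains every
T_s x, since the range of T_s is dense and T_s commutes with the orbit. *)
Lemma generic_hypercyclic x : hypercyclic_vector T x ->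
  generic (hypercyclic_vector T).
Proof.
move=> hx'; have hx := (hypercyclic_normP x).1 hx'.
(* nonnegative rational times, dense in time, give countably many centres
   T (q i) x that are dense in X *)
pose q (i : nat * nat) : R := i.1%:R / i.2.+1%:R.
have q0 i : 0 <= q i by rewrite divr_ge0.
have qdense (t d : R) : 0 <= t -> 0 < d -> exists i, `|q i - t| < d.
  move=> t0 d0; have [b bd] := nat_above d^-1.
  have tb0 : 0 <= t * b.+1%:R by rewrite mulr_ge0.
  exists (Num.truncn (t * b.+1%:R), b); rewrite /q/=.
  have /andP[h1 h2] := truncn_itv tb0.
  have b0 : 0 < b.+1%:R :> R by [].
  have b1d : b.+1%:R^-1 < d by rewrite -[ltRHS]invrK ltf_pV2 ?posrE ?invr_gt0.
  have h3 : (Num.truncn (t * b.+1%:R))%:R / b.+1%:R <= t by rewrite ler_pdivrMr.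
  have h4 : t < (Num.truncn (t * b.+1%:R))%:R / b.+1%:R + b.+1%:R^-1.
    by rewrite -{2}[b.+1%:R^-1]mul1r -mulrDl ltr_pdivlMr// natr1.
  by rewrite distrC ger0_norm ?subr_ge0// (lt_trans _ b1d)// ltrBlDl.
(* T r has dense range: the range is a subspace, so if it misses a ball away
   from 0, it misses the multiples of that ball, which can then be met by the
   orbit of x only before time r, where this orbit is bounded *)
have range_dense r (v : X) (e : K) : 0 <= r -> 0 < e ->
    exists w, `|T r w - v| < e.
  move=> r0 e0; have [v0|v0] := eqVneq v 0.
    by exists 0; rewrite linear0 v0 subrr normr0.
  have [C C0 CT] := locally_bounded arch T_C0 r.
  apply: contrapT => /forallNP H.
  (* a radius below both e and half of the norm of v, by harmonic sum *)
  pose e' : K := e / (1 + e / (`|v| / 2)).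
  have nv0 : 0 < `|v| by rewrite normr_gt0.
  have p0 : 0 < 1 + e / (`|v| / 2) by rewrite addr_gt0// !divr_gt0.
  have e'0 : 0 < e' by rewrite divr_gt0.
  have e'e : e' <= e.
    by rewrite ler_pdivrMr// ler_pMr// lerDl !divr_ge0// ltW.
  have e'v : e' < `|v| / 2.
    rewrite ltr_pdivrMr// mulrDr mulr1 [_ * (e / _)]mulrC divfK.
      by rewrite ltrDr divr_gt0.
    by rewrite gt_eqF// divr_gt0.
  have Cx0 : 0 <= C * `|x| / (`|v| / 2) by rewrite !mulr_ge0 ?invr_ge0// ltW.
  have [n nP] := arch Cx0.
  have n0 : 0 < n.+1%:R :> K by [].
  have [t t0] := hx (n.+1%:R *: v) (n.+1%:R * e') (mulr_gt0 n0 e'0).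
  have -> : T t x - n.+1%:R *: v = n.+1%:R *: (n.+1%:R^-1 *: T t x - v).
    by rewrite scalerBr scalerA divff ?scale1r// gt_eqF.
  rewrite normrZ ger0_norm// ltr_pM2l// => tv.
  have [rt|tr] := leP r t.
    apply: (H (n.+1%:R^-1 *: T (t - r) x)).
    rewrite linearZ/= -(C0_add T_C0)//; last by rewrite subr_ge0.
    by rewrite [r + _]addrC subrK (lt_le_trans tv).
  have := CT t x t0 (ltW tr); apply/negP.
  rewrite -real_ltNge ?normr_real ?(ger0_real (mulr_ge0 (ltW C0) (normr_ge0 x)))//.
  move: nP; rewrite ltr_pdivrMr ?divr_gt0// => /lt_trans; apply.
  rewrite -ltr_pdivlMl//.
  rewrite -[X in _ < X * _](gtr0_norm (_ : 0 < n.+1%:R^-1)) ?invr_gt0// -normrZ.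
  set w := _ *: T t x in tv *.
  have : `|v| < `|w| + `|v| / 2.
    rewrite -{1}[v](subrKC w) (le_lt_trans (ler_normD _ _))// ltrD2l distrC.
    exact: lt_trans e'v.
  by rewrite {1}[`|v|]splitr ltrD2r.
pose U (ik : (nat * nat) * nat) : set X := \bigcup_(t in [set t | 0 <= t])
  [set y | `|T t y - T (q ik.1) x| < ik.2.+1%:R^-1].
suff : generic (fun y => forall ik, U ik y).
  apply: genericS => y Uy; apply/hypercyclic_normP => v r r0.
  have r30 : 0 < r / 2 / 2 by rewrite !divr_gt0.
  have [s s0 sv] := hx v (r / 2 / 2) r30.
  have [d d0 dT] := C0_norm_cont T_C0 x s0 r30.
  have [i iq] := qdense s d s0 d0.
  have [k kr] := arch_inv arch (divr_gt0 r0 (@ltr0Sn K 1)).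
  have [t t0 /= tU] := Uy (i, k); exists t => //.
  rewrite -(subrKA (T (q i) x)) (le_lt_trans (ler_normD _ _))//.
  rewrite [r]splitr ltrD ?(lt_trans tU)//.
  rewrite -(subrKA (T s x)) (le_lt_trans (ler_normD _ _))//.
  by rewrite [X in _ < X]splitr ltrD// dT.
apply: (generic_forall arch) => -[i k]; apply: open_dense_generic.
  apply: bigcup_open => t /= t0; apply/open_normP => y /= yt.
  have [M M0 MT] := C0_bounded_pos T_C0 t0.
  exists ((k.+1%:R^-1 - `|T t y - T (q i) x|) / M).
    by rewrite divr_gt0// subr_gt0.
  move=> z; rewrite ltr_pdivlMr// mulrC ltrBrDr => zy.
  rewrite -(subrKA (T t y)) (le_lt_trans (ler_normD _ _))//.
  by rewrite -linearB (le_lt_trans _ zy)// lerD2r.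
apply/dense_normP => v r r0; have [s s0 sv] := hx v r r0.
exists (T s x) => //=.
have k20 : 0 < k.+1%:R^-1 / 2 :> K by rewrite divr_gt0.
have [w wq] := range_dense s (T (q i) x) _ s0 k20.
have [M M0 MT] := C0_bounded_pos T_C0 s0.
have [t t0 tw] := hx w (k.+1%:R^-1 / 2 / M) (divr_gt0 k20 M0).
exists t => //=; rewrite (T_commute T_C0)//.
rewrite -(subrKA (T s w)) (le_lt_trans (ler_normD _ _))//.
rewrite [X in _ < X]splitr ltrD// -linearB (le_lt_trans (MT _))//.
by rewrite mulrC -ltr_pdivlMr.
Qed.

End hypercyclic.

(** * Frequency of approach to zero and to infinity *)

Section dichotomy.
Context {R : realType} {K : numFieldType} {X : completeNormedModType K}.
Hypothesis arch : forall x : K, 0 <= x -> exists n : nat, x < n.+1%:R.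
Variable T : R -> {linear X -> X}.
Hypothesis T_C0 : C0_semigroup T.
Local Notation visit := (visit T).

(** Neighbourhoods of zero (true) and of infinity (false), shrinking with r. The
arguments at both ends are the same, because multiplication by nonzero scalars carries
any of these neighbourhoods into any other at the same end, and the complement
of one is contained in one at the other end. *)
Definition end_nbhs (b : bool) (r : K) : set X :=
  [set v | if b then `|v| < r else r^-1 < `|v|].

Lemma open_end_nbhs b r : open (end_nbhs b r).
Proof.
apply/open_normP => v; rewrite /end_nbhs/=; case: b => vr.
  exists (r - `|v|); first by rewrite subr_gt0.
  by move=> u uv; rewrite -(subrK v u) (le_lt_trans (ler_normD _ _))// -ltrBrDr.
exists (`|v| - r^-1); first by rewrite subr_gt0.
move=> u; rewrite ltrBrDr -ltrBrDl => /lt_le_trans; apply.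
by rewrite lerBlDr -{1}(subKr u v) (le_trans (ler_normB _ _))// distrC.
Qed.

Lemma end_nbhsS b r r' : 0 < r -> r <= r' -> end_nbhs b r `<=` end_nbhs b r'.
Proof.
move=> r0 rr' v; have r'0 := lt_le_trans r0 rr'; rewrite /end_nbhs/=; case: b => vr.
  exact: lt_le_trans rr'.
by rewrite (le_lt_trans _ vr)// lef_pV2.
Qed.

Lemma end_nbhs_scale b r r' : 0 < r -> 0 < r' -> exists2 a : K, a != 0 &
  forall v, end_nbhs b r v -> end_nbhs b r' (a *: v).
Proof.
move=> r0 r'0; rewrite /end_nbhs; case: b => /=.
  exists (r' / r); first by rewrite gt_eqF// divr_gt0.
  move=> v vr; rewrite normrZ gtr0_norm ?divr_gt0//.
  by rewrite -mulrA gtr_pMr// mulrC ltr_pdivrMr// mul1r.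
exists (r / r'); first by rewrite gt_eqF// divr_gt0.
move=> v vr; rewrite normrZ gtr0_norm ?divr_gt0//.
by rewrite mulrAC ltr_pMl ?invr_gt0// -ltr_pdivrMl// mulr1.
Qed.

Lemma end_nbhsC b r v : 0 < r -> ~ end_nbhs b r v -> end_nbhs (~~ b) (2 / r) v.
Proof.
move=> r0; rewrite /end_nbhs/=; case: b => /= /negP.
  rewrite -real_leNgt ?normr_real ?gtr0_real// => rv.
  rewrite invfM invrK (lt_le_trans _ rv)// mulrC ltr_pdivrMr//.
  by rewrite mulr_natr mulr2n ltrDl.
rewrite -real_leNgt ?normr_real ?gtr0_real ?invr_gt0// => /le_lt_trans; apply.
by rewrite mulr_natl mulr2n ltrDl invr_gt0.
Qed.

Definition end_ball b (k : nat) := end_nbhs b k.+1%:R^-1.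

Lemma invS_gt0 (k : nat) : 0 < k.+1%:R^-1 :> K. Proof. by rewrite invr_gt0. Qed.

Lemma end_ballS b j k : (j <= k)%N -> end_ball b k `<=` end_ball b j.
Proof.
by move=> jk; apply: end_nbhsS => //; rewrite lef_pV2 ?posrE// ler_nat.
Qed.

Definition tends b x (A : set R) := forall k, exists N : R, forall t, N < t ->
  A t -> end_ball b k (T t x).

Lemma tends_zeroP x A : tends_to_zero_along T x A <-> tends true x A.
Proof.
split=> [/cvgrPdist_lt H k|H].
  have [N [_ NA]] := H _ (invS_gt0 k); exists N => t Nt At.
  by have := NA t Nt At; rewrite sub0r normrN normr_id.
apply/cvgrPdist_lt => e e0; have [k ke] := arch_inv arch e0.
have [N NA] := H k; exists N; rewrite num_real; split=> // t Nt At.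
by rewrite sub0r normrN normr_id (lt_trans _ ke)//; exact: NA.
Qed.

Lemma tends_inftyP x A : tends_to_infinity_along T x A <-> tends false x A.
Proof.
split=> H.
  move=> k; have [|N [_ NA]] := H [set v | k.+1%:R < v].
    by exists k.+1%:R; rewrite realn.
  exists N => t Nt At; rewrite /end_ball /end_nbhs/= invrK; exact: NA.
move=> P [M [Mreal MP]]; have [k Mk] := arch (normr_ge0 M).
have [N NA] := H k; exists N; rewrite num_real; split=> // t Nt At.
apply: MP; rewrite (le_lt_trans (real_ler_norm Mreal))// (lt_trans Mk)//.
by have := NA t Nt At; rewrite /end_ball /end_nbhs/= invrK.
Qed.

Definition frequent b x (c : R) := forall k, often (visit (end_ball b k) x) c.

Definition density_one b x := forall k c, c < 1 -> always (visit (end_ball b k) x) c.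

Lemma visit_ball_mono b x j k : (j <= k)%N ->
  visit (end_ball b k) x `<=` visit (end_ball b j) x.
Proof. by move=> jk; apply: visitS; exact: end_ballS. Qed.

Lemma measurable_visit_ball b r x :
  measurable (visit (end_nbhs b r) x : set (measurableTypeR R)).
Proof. by apply: measurable_visit => //; exact: open_end_nbhs. Qed.

Lemma frequent_tends b x d : (forall c, c < d -> frequent b x c) ->
  exists A, [/\ time_set A, (d%:E <= upper_Dens A)%E & tends b x A].
Proof.
move=> H; have [|||A [tA AS dA]] :=
  @diagonal_often _ (fun k => visit (end_ball b k) x) _ _ d.
- by move=> k; exact: measurable_visit_ball.
- exact: visit_ball_mono.
- by move=> k c cd; exact: H.
exists A; split=> // k; have [N NA] := AS k; exists N => t Nt At.
by have [] := NA t Nt At.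
Qed.

Lemma tends_time_in b x A k : tends b x A -> exists N, forall t, 0 <= t ->
  time_in A t <= time_in (visit (end_ball b k) x) t + N.
Proof.
move=> /(_ k)[N NA]; exists `|N| => t t0.
apply: (@le_trans _ _ (time_in (visit (end_ball b k) x `|` `[0, `|N|]) t)).
  apply: time_in_le => // s [As]; rewrite /= in_itv/= => /andP[s0 _].
  have [sN|Ns] := leP s `|N|; [right|left]; first by rewrite /= in_itv/= s0.
  by split=> //; apply: NA => //; apply: le_lt_trans Ns; exact: ler_norm.
by rewrite (le_trans (time_inU _ _ t0))// lerD2l time_in_early.
Qed.

Lemma tends_frequent b x A (c c' : R) : c < c' -> (c'%:E < upper_Dens A)%E ->
  tends b x A -> frequent b x c.
Proof.
move=> cc' /upper_Dens_gt oA tA k; have [N NA] := tends_time_in k tA.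
exact: often_perturb cc' NA oA.
Qed.

Lemma density_oneP b x : density_one b x <->
  exists A, [/\ time_set A, has_Dens A 1%E & tends b x A].
Proof.
split=> [H|[A [_ /has_Dens1 dA tA]] k c c1].
  have [||A [tA AS dA]] := @diagonal_always _ (fun k => visit (end_ball b k) x) _ _ H.
  - by move=> k; exact: measurable_visit_ball.
  - exact: visit_ball_mono.
  exists A; split=> // k; have [N NA] := AS k; exists N => t Nt At.
  by have [] := NA t Nt At.
have [N NA] := tends_time_in k tA.
by apply: always_perturb NA (dA ((c + 1) / 2) _); lra.
Qed.

Lemma density_one_frequent b x (c : R) : 0 < c -> density_one b x ->
  frequent (~~ b) x c -> False.
Proof.
move=> c0 d1 fr.
have dis : visit (end_ball (~~ b) 0) x `<=` ~` visit (end_ball b 0) x.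
  move=> s [_]; rewrite /end_ball /end_nbhs/= !invr1 => h [_].
  move: h; case: b {d1 fr} => /= h1 h2.
    by have := lt_trans h1 h2; rewrite ltxx.
  by have := lt_trans h1 h2; rewrite ltxx.
apply: (often_always _ dis _ (d1 0%N (1 - c) _) (fr 0%N)); [|lra|lra].
by apply: borel_lebesgue; exact: measurable_visit_ball.
Qed.

(** The neighbourhood of the other end is large, but scaling will shrink it. *)
Lemma not_density_one b x : ~ density_one b x -> exists r c,
  [/\ 0 < r, 0 < c & often (visit (end_nbhs (~~ b) r) x) c].
Proof.
move=> /existsNP[k /existsNP[c /not_implyP[c1 nc]]].
exists (2 / k.+1%:R^-1), ((1 - c) / 2); split; [exact: divr_gt0|lra|].
apply: not_always_often nc; [|move=> s [ns]|lra].
  by apply: borel_lebesgue; exact: measurable_visit_ball.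
rewrite /= in_itv/= andbT => s0; split=> //; apply: end_nbhsC => // h.
exact: ns.
Qed.

(** One neighbourhood, however large, visited by one hypercyclic vector yields
all neighbourhoods at generic vectors, at nearly the same rate. *)
Lemma generic_frequent b x r (c c' : R) : hypercyclic_vector T x -> 0 < r ->
  c < c' -> often (visit (end_nbhs b r) x) c' ->
  generic (fun y => frequent b y c).
Proof.
move=> hx r0 cc' oft; apply: (generic_often arch T_C0 hx _ _ _ cc' oft).
- exact: open_end_nbhs.
- by move=> k; exact: open_end_nbhs.
- by move=> k; exact: end_nbhs_scale.
Qed.

(** With half radii, x + y can be far from zero only when x or y is. *)
Lemma density_one_zeroD x y : density_one true x -> density_one true y ->
  density_one true (x + y).
Proof.
move=> dx dy k c c1.
pose k' := (k.+1 * 2).-1.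
have k'E : k'.+1 = (k.+1 * 2)%N by rewrite /k' prednK// muln_gt0.
have c2 : (1 + c) / 2 < 1 by lra.
have [N Nx] := dx k' _ c2; have [M My] := dy k' _ c2.
exists (Num.max 0 (Num.max N M)) => t; rewrite !gt_max => /and3P[t0 Nt Mt].
have mv b r z := borel_lebesgue (measurable_visit_ball b r z).
have := Nx t Nt; have := My t Mt.
have := time_inC (mv true k'.+1%:R^-1 x) (ltW t0).
have := time_inC (mv true k'.+1%:R^-1 y) (ltW t0).
have := time_inC (mv true k.+1%:R^-1 (x + y)) (ltW t0).
have : time_in (~` visit (end_ball true k) (x + y)) t <=
    time_in (~` visit (end_ball true k') x) t +
    time_in (~` visit (end_ball true k') y) t.
  apply: le_trans (time_inU _ _ (ltW t0)).
  apply: time_in_le (ltW t0) _ => s [H]; rewrite /= in_itv/= => /andP[s0 _].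
  apply: contrapT => /not_orP[/contrapT[_ sx] /contrapT[_ sy]]; apply: H; split=> //.
  move: sx sy; rewrite /end_ball /end_nbhs/= => sx sy.
  rewrite linearD (le_lt_trans (ler_normD _ _))//.
  have -> : k.+1%:R^-1 = k'.+1%:R^-1 + k'.+1%:R^-1 :> K.
    by rewrite k'E natrM invfM -splitr.
  exact: ltrD.
rewrite /end_ball; nra.
Qed.

Lemma asymptotic_to_zeroP x : asymptotic_to_zero_density_one T x <-> density_one true x.
Proof.
rewrite density_oneP; split=> -[A [? ? /tends_zeroP ?]]; exists A; split=> //.
Qed.

Lemma divergentP x : divergent_to_infinity_density_one T x <-> density_one false x.
Proof.
rewrite density_oneP; split=> -[A [? ? /tends_inftyP ?]]; exists A; split=> //.
Qed.

Lemma type1P x : dist_irregular_type1 T x <->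
  forall b c, c < 1 -> frequent b x c.
Proof.
split=> [[A [B [_ _ [dA dB] /tends_zeroP tA /tends_inftyP tB]]] b c c1|H].
  have cc' : c < (c + 1) / 2 by lra.
  have c'1 : (c + 1) / 2 < 1 by lra.
  by case: b; [apply: tends_frequent cc' _ tA|apply: tends_frequent cc' _ tB];
    rewrite ?dA ?dB lte_fin.
have [A [tA dA /tends_zeroP zA]] := frequent_tends (H true).
have [B [tB dB /tends_inftyP iB]] := frequent_tends (H false).
by exists A, B; split=> //; split; apply/eqP; rewrite eq_le upper_Dens_le1.
Qed.

Lemma frequent_lt b x (c c' : R) : c < c' -> frequent b x c' -> frequent b x c.
Proof.
by move=> cc' fr k; apply: (often_perturb (r := 0) cc' _ (fr k)) => t _; rewrite addr0.
Qed.

Lemma tends_frequent_pos b x A : (0 < upper_Dens A)%E -> tends b x A ->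
  exists2 c, 0 < c & frequent b x c.
Proof.
move=> A0 tA; have [c c0 cA] : exists2 c, 0 < c & (c%:E < upper_Dens A)%E.
  move: A0 (upper_Dens_le1 A); case: (upper_Dens A) => [u||]//.
  rewrite lte_fin => u0 _; exists (u / 2); first by rewrite divr_gt0.
  by rewrite lte_fin ltr_pdivrMr// ltr_pMr// ltr1n.
exists (c / 2); first by rewrite divr_gt0.
by apply: tends_frequent cA tA; lra.
Qed.

Lemma type2halfP x : dist_irregular_type2half T x <->
  forall b, exists2 c, 0 < c & frequent b x c.
Proof.
split=> [[A [B [_ _]]]|H].
  rewrite mule_ge0_gt0 ?upper_Dens_ge0// => /andP[A0 B0].
  move=> /tends_zeroP tA /tends_inftyP tB.
  by case; [exact: tends_frequent_pos A0 tA|exact: tends_frequent_pos B0 tB].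
have {}H b : exists A, [/\ time_set A, (0 < upper_Dens A)%E & tends b x A].
  have [c c0 fr] := H b.
  have [A [tA cA zA]] := frequent_tends (fun c' c'c => frequent_lt c'c fr).
  by exists A; split=> //; apply: lt_le_trans cA; rewrite lte_fin.
have [A [tA dA /tends_zeroP zA]] := H true.
have [B [tB dB /tends_inftyP iB]] := H false.
by exists A, B; split=> //; exact: mule_gt0.
Qed.

Lemma type1_type2half x : dist_irregular_type1 T x -> dist_irregular_type2half T x.
Proof.
move=> [A [B [tA tB [dA dB] zA iB]]]; exists A, B; split=> //.
by rewrite dA dB mule1.
Qed.

End dichotomy.

(** * The four cases *)

Section classification.
Context {R : realType} {K : numFieldType} {X : completeNormedModType K}.
Hypothesis arch : forall x : K, 0 <= x -> exists n : nat, x < n.+1%:R.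
Variable T : R -> {linear X -> X}.
Hypothesis T_C0 : C0_semigroup T.
Hypothesis T_hypercyclic : hypercyclic T.

Lemma generic_hypercyclic_exists (P : X -> Prop) : generic P ->
  exists x, hypercyclic_vector T x /\ P x.
Proof.
move=> gP; have [x0 hx0] := T_hypercyclic.
have [x [hx Px]] :=
  generic_exists (genericI arch (generic_hypercyclic arch T_C0 hx0) gP).
by exists x.
Qed.

Lemma generic_type1 x : hypercyclic_vector T x -> dist_irregular_type1 T x ->
  generic (dist_irregular_type1 T).
Proof.
move=> hx /(type1P arch T_C0) fx.
have : generic (fun y => forall bn : bool * nat,
    frequent T bn.1 y (1 - bn.2.+1%:R^-1)).
  apply: (generic_forall arch) => -[b n] /=.
  have cc' : 1 - n.+1%:R^-1 < 1 - n.+2%:R^-1 :> R.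
    by rewrite ltrD2l ltrN2 ltf_pV2 ?posrE// ltr_nat.
  apply: (generic_frequent arch T_C0 hx (invS_gt0 0) cc').
  by apply: fx; rewrite ltrBlDr ltrDl.
apply: genericS => y fy; apply/(type1P arch T_C0) => b c /rate_approx[n nc].
apply: (frequent_lt (c' := 1 - n.+2%:R^-1)); last exact: (fy (b, n.+1)).
by apply: le_lt_trans (nc n (leqnn n)) _; rewrite ltrD2l ltrN2 ltf_pV2 ?posrE// ltr_nat.
Qed.

(** A hypercyclic vector that fails to have density one at one end visits some
neighbourhood of the other end at a positive rate. *)
Lemma generic_type2half x y :
  hypercyclic_vector T x -> ~ density_one T false x ->
  hypercyclic_vector T y -> ~ density_one T true y ->
  generic (dist_irregular_type2half T).
Proof.
have H b z : hypercyclic_vector T z -> ~ density_one T (~~ b) z ->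
    exists c, 0 < c /\ generic (fun w => frequent T b w c).
  move=> hz /(not_density_one T_C0)[r [c [r0 c0]]]; rewrite negbK => oft.
  exists (c / 2); split; first by rewrite divr_gt0.
  apply: (generic_frequent arch T_C0 hz r0 _ oft); lra.
move=> hx nx hy ny.
have [c [c0 gc]] := H true x hx nx; have [d [d0 gd]] := H false y hy ny.
apply: genericS (genericI arch gc gd) => w [fc fd].
by apply/(type2halfP arch T_C0); case; [exists c|exists d].
Qed.

Lemma classification :
  exactly_one_of_four
    (forall x : X, asymptotic_to_zero_density_one T x)
    (generic (fun x : X => dist_irregular_type1 T x))
    (generic (fun x : X => dist_irregular_type2half T x) /\
     ~ (exists x : X, hypercyclic_vector T x /\ dist_irregular_type1 T x))
    (forall x : X, hypercyclic_vector T x ->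
       divergent_to_infinity_density_one T x).
Proof.
set P1 := forall x, asymptotic_to_zero_density_one _ _.
set P2 := generic (fun x => dist_irregular_type1 _ _).
set P3 := _ /\ ~ _.
set P4 := forall x, hypercyclic_vector _ _ -> _.
have dense_half : P2 \/ P3 -> exists x, hypercyclic_vector T x /\
    dist_irregular_type2half T x.
  move=> H; apply: generic_hypercyclic_exists; case: H => [gP|[gP _]//].
  by apply: genericS gP => x; exact: type1_type2half.
have clash b x : density_one T b x -> ~ dist_irregular_type2half T x.
  move=> dx /(type2halfP arch T_C0) /(_ (~~ b))[c c0 fc].
  exact: (density_one_frequent T_C0 c0 dx fc).
have P1half : P1 -> ~ (P2 \/ P3).
  move=> p1 /dense_half[x [_]].
  by apply: (clash true); apply/(asymptotic_to_zeroP arch T_C0); exact: p1.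
have P4half : P4 -> ~ (P2 \/ P3).
  move=> p4 /dense_half[x [hx]].
  by apply: (clash false); apply/(divergentP arch T_C0); exact: p4.
have P14 : P1 -> ~ P4.
  move=> p1 p4; have [x hx] := T_hypercyclic.
  have d0 := (asymptotic_to_zeroP arch T_C0 x).1 (p1 x).
  have d1 := (divergentP arch T_C0 x).1 (p4 x hx).
  have half0 : 0 < 1 / 2 :> R by [].
  apply: (density_one_frequent T_C0 half0 d0) => k.
  by apply: always_often; apply: d1; lra.
have P23 : P2 -> ~ P3.
  by move=> p2 [_]; apply; exact: generic_hypercyclic_exists.
have : P1 \/ P2 \/ P3 \/ P4.
  have [[x [hx tx]]|no1] := pselect (exists x, hypercyclic_vector T x /\
      dist_irregular_type1 T x).
    by right; left; exact: generic_type1 tx.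
  have [all1|/existsNP[y /not_implyP[hy ny]]] := pselect (forall x,
      hypercyclic_vector T x -> density_one T true x).
    left=> x; apply/(asymptotic_to_zeroP arch T_C0).
    have [x0 hx0] := T_hypercyclic.
    have [h1 [h2 [H1 H2 ->]]] :=
      generic_sum arch x (generic_hypercyclic arch T_C0 hx0).
    by apply: (density_one_zeroD T_C0); exact: all1.
  have [all4|/existsNP[x /not_implyP[hx nx]]] := pselect (forall x,
      hypercyclic_vector T x -> density_one T false x).
    by do 3 right; move=> x hx; apply/(divergentP arch T_C0); exact: all4.
  right; right; left; split=> //.
  exact: generic_type2half hx nx hy ny.
rewrite /exactly_one_of_four; case=> [p1|[p2|[p3|p4]]].
- constructor 1; split=> // [p|p|]; [apply: (P1half p1); tauto..|exact: P14].
- constructor 2; split=> // [p|p|p]; [apply: (P1half p); tauto|exact: (P23 p2)|].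
  by apply: (P4half p); tauto.
- constructor 3; split=> // [p|p|p]; [apply: (P1half p); tauto|exact: (P23 p)|].
  by apply: (P4half p); tauto.
- constructor 4; split=> // [p|p|p]; [exact: (P14 p)|apply: (P4half p4); tauto..].
Qed.


End classification.

Lemma scalars_archimedean (R : realType) (b : bool) (x : scalars R b) :
  0 <= x -> exists n : nat, x < n.+1%:R.
Proof.
case: b x => /= [[a b]|x _]; last exact: nat_above.
rewrite lecE/= => /andP[/eqP b0 _]; have [n an] := nat_above a; exists n.
have -> : n.+1%:R = (n.+1%:R)%:C%C :> R[i]%C by rewrite rmorph_nat.
by rewrite ltcE/= b0 eqxx.
Qed.

Theorem theorem4p5 (R : realType) (is_complex : bool)
    (X : completeNormedModType (scalars R is_complex))
    (T : R -> {linear X -> X})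
    (T_C0 : C0_semigroup T) (T_hypercyclic : hypercyclic T) :
  exactly_one_of_four
    (forall x : X, asymptotic_to_zero_density_one T x)
    (generic (fun x : X => dist_irregular_type1 T x))
    (generic (fun x : X => dist_irregular_type2half T x) /\
     ~ (exists x : X, hypercyclic_vector T x /\ dist_irregular_type1 T x))
    (forall x : X, hypercyclic_vector T x ->
       divergent_to_infinity_density_one T x).
Proof. exact (classification (@scalars_archimedean R is_complex) T_C0 T_hypercyclic). Qed.
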